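(* For an algebra $\mathcal{B}$ in a functional language $\mathtt{L}$ the following conditions are equivalent: 1) $\mathcal{B}$ is weakly $\mathrm{u}_\omega$-compact; 2) every non-empty logically irreducible algebraic set over $\mathcal{B}$ is irreducible; 3) every non-trivial coordinate algebra over $\mathcal{B}$ that belongs to $\mathbf{Ucl}(\mathcal{B})$ is irreducible (that is, is an irreducible coordinate algebra over $\mathcal{B}$); 4) $\mathbf{Ucl}(\mathcal{B})\cap\mathbf{Res}(\mathcal{B})_\omega=(\mathbf{Dis}(\mathcal{B})_{\mathbf{e}})_\omega$.
   Context: A functional language $\mathtt{L}$ is a first-order language with function and constant symbols only (and equality); $\mathtt{L}$-structures are called $\mathtt{L}$-algebras. For a finite set of variables $X=\{x_1,\dots,x_n\}$, $\mathcal{T}_{\mathtt{L}}(X)$ is the absolutely free algebra of terms, and $\mathrm{At}_{\mathtt{L}}(X)$ is the set of atomic formulas $(t=s)$ in variables $X$ (equations). For $S\subseteq \mathrm{At}_{\mathtt{L}}(X)$, $\mathrm{V}_{\mathcal{B}}(S)\subseteq B^n$ is its solution set in $\mathcal{B}$, where $B$ is the universe of $\mathcal{B}$; sets of this form are the algebraic sets over $\mathcal{B}$. An algebraic set is irreducible if it is non-empty and is not a finite union of proper algebraic subsets. The radical $\mathrm{Rad}(Y)$ of an algebraic set $Y\subseteq B^n$ is the set of all $(t=s)\in\mathrm{At}_{\mathtt{L}}(X)$ holding at all points of $Y$, and the coordinate algebra of $Y$ is $\Gamma(Y)=\mathcal{T}_{\mathtt{L}}(X)/\theta_{\mathrm{Rad}(Y)}$,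 where $\theta_{\mathrm{Rad}(Y)}$ is the congruence with $t_1\sim t_2$ iff $(t_1=t_2)\in\mathrm{Rad}(Y)$. An algebra is a coordinate algebra (resp. irreducible coordinate algebra) over $\mathcal{B}$ if it is isomorphic to $\Gamma(Y)$ for some algebraic set (resp. irreducible algebraic set) $Y$ over $\mathcal{B}$. $\mathbf{Ucl}(\mathcal{B})$ is the class of models of all universal sentences true in $\mathcal{B}$. An algebraic set $Y$ over $\mathcal{B}$ is logically irreducible if $\Gamma(Y)\in\mathbf{Ucl}(\mathcal{B})$. $\mathcal{B}$ is weakly $\mathrm{u}_\omega$-compact if each non-empty algebraic set $Y$ over $\mathcal{B}$ whose coordinate algebra $\Gamma(Y)$ belongs to $\mathbf{Ucl}(\mathcal{B})$ is irreducible. $\mathcal{E}$ denotes the trivial (one-element) $\mathtt{L}$-algebra. $\mathbf{Res}(\mathcal{B})$ is the class of algebras separated by $\mathcal{B}$: $\mathcal{C}$ is separated by $\mathcal{B}$ if for any $c_1\ne c_2$ in $C$ (the universe of $\mathcal{C}$) some homomorphism $h\colon\mathcal{C}\to\mathcal{B}$ has $h(c_1)\ne h(c_2)$ (by convention $\mathcal{E}$ is separated by every $\mathcal{B}$). $\mathbf{Dis}(\mathcal{B})$ is the class of algebras discriminated by $\mathcal{B}$: $\mathcal{C}$ is discriminated by $\mathcal{B}$ if for any finite $W\subseteq C$ there is a homomorphism $h\colon\mathcal{C}\to\mathcal{B}$ injective on $W$ (by convention $\mathcal{E}$ is discriminated by $\mathcal{B}$ iff $\mathcal{B}$ has a trivial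 subalgebra). For a class $\mathbf{K}$ of $\mathtt{L}$-algebras, $\mathbf{K}_{\mathbf{e}}=\mathbf{K}\cup\{\mathcal{E}\}$ and $\mathbf{K}_\omega$ is the class of finitely generated algebras from $\mathbf{K}$.
   Formalization: Condition 4 as printed forces E ∈ Ucl(B), which 1–3 do not (e.g. constants 0,1 with B={0,1}); it is replaced by Ucl(B)_e ∩ Res(B)_ω = (Dis(B)_e)_ω, and the printed condition 4 is shown equivalent to: 1) holds and E ∈ Ucl(B). *)

(* Defs.v *)
From HB Require Import structures.
From mathcomp Require Import all_boot generic_quotient.
From mathcomp Require Import all_classical.

Set Implicit Arguments.
Unset Strict Implicit.
Unset Printing Implicit Defensive.

Local Open Scope classical_set_scope.
Local Open Scope quotient_scope.

(* Constants are the symbols of arity 0. *)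
Record language := Language { symb : Type; arity : symb -> nat }.

Record algebra (L : language) := Algebra {
  carrier :> Type;
  interp : forall f : symb L, ('I_(arity f) -> carrier) -> carrier;
  carrier_inhabited : inhabited carrier }.

Inductive term (L : language) (X : Type) :=
| Var of X
| App (f : symb L) of ('I_(arity f) -> term L X).
Arguments Var {L X} _.
Arguments App {L X} f _.

Section Algebras.
Variable L : language.
Implicit Types A B C : algebra L.

Definition hom A B (h : A -> B) :=
  forall (f : symb L) (a : 'I_(arity f) -> A),
    h (interp a) = interp (fun i => h (a i)).

Definition isomorphic A B := exists h : A -> B, hom h /\ bijective h.

Definition trivial_algebra : algebra L :=
  @Algebra L unit (fun _ _ => tt) (inhabits tt).

Definition trivial A := isomorphic A trivial_algebra.

Definition subuniverse A (P : set A) :=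
  forall (f : symb L) (a : 'I_(arity f) -> A),
    (forall i, P (a i)) -> P (interp a).

Definition finitely_generated A :=
  exists W : set A, finite_set W /\ smallest (@subuniverse A) W = setT.

Fixpoint eval (X : Type) A (p : X -> A) (t : term L X) : A :=
  match t with
  | Var x => p x
  | App f ts => interp (fun i => eval p (ts i))
  end.

(* The equation t = s is the pair (t, s). *)
Definition equation (X : Type) := (term L X * term L X)%type.

Definition satisfies (X : Type) A (p : X -> A) (e : equation X) :=
  eval p e.1 = eval p e.2.

Inductive qf_formula (X : Type) :=
| QEq of equation X
| QNot of qf_formula X
| QAnd of qf_formula X & qf_formula X
| QOr of qf_formula X & qf_formula X.

Fixpoint holds (X : Type) A (p : X -> A) (phi : qf_formula X) : Prop :=
  match phi with
  | QEq e => satisfies p e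
  | QNot phi1 => ~ holds p phi1
  | QAnd phi1 phi2 => holds p phi1 /\ holds p phi2
  | QOr phi1 phi2 => holds p phi1 \/ holds p phi2
  end.

(* (n; phi) stands for the sentence "for all x_1, ..., x_n, phi". *)
Definition universal_sentence := {n : nat & qf_formula 'I_n}.

Definition models A (phi : universal_sentence) :=
  forall p : 'I_(projT1 phi) -> A, holds p (projT2 phi).

(* Classes of algebras are plain predicates: the library's set cannot be used
   at the universe of algebra L. *)
Definition Ucl B C : Prop := forall phi, models B phi -> models C phi.

(* The one-element algebra satisfies this for every B. *)
Definition Res B C : Prop := forall c1 c2 : C, c1 <> c2 ->
  exists h : C -> B, hom h /\ h c1 <> h c2.

(* A map out of a one-element algebra is always injective, and it is a
   homomorphism iff its value is a one-element subalgebra; hence the usual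
   convention about the trivial algebra needs no separate clause. *)
Definition Dis B C : Prop := forall W : set C, finite_set W ->
  exists h : C -> B, hom h /\ set_inj W h.

(* Classes of algebras are closed under isomorphism, so all one-element
   algebras are added, not only the one carried by unit. *)
Definition with_trivial (K : algebra L -> Prop) C : Prop := K C \/ trivial C.

Definition fin_gen (K : algebra L -> Prop) C : Prop :=
  K C /\ finitely_generated C.

(* Points of B^(n+1) are maps 'I_n.+1 -> B; at least one variable is required
   so that the term algebra is non-empty whatever the language. *)
Section AlgebraicSets.
Variable B : algebra L.

Definition V (n : nat) (S : set (equation 'I_n.+1)) : set ('I_n.+1 -> B) :=
  [set p | forall e, S e -> satisfies p e].

Definition algebraic n (Y : set ('I_n.+1 -> B)) := exists S, Y = V S.

Definition irreducible n (Y : set ('I_n.+1 -> B)) :=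
  [/\ algebraic Y, Y !=set0 &
    ~ exists (k : nat) (Z : 'I_k -> set ('I_n.+1 -> B)),
        (forall i, algebraic (Z i) /\ Z i `<` Y) /\
        Y = \bigcup_(i in setT) Z i].

Definition Rad n (Y : set ('I_n.+1 -> B)) : set (equation 'I_n.+1) :=
  [set e | forall p, Y p -> satisfies p e].

End AlgebraicSets.
End Algebras.

(* Classical equality and choice, required to form quotients. *)
HB.instance Definition _ (L : language) (X : Type) :=
  gen_eqMixin (term L X).
HB.instance Definition _ (L : language) (X : Type) :=
  gen_choiceMixin (term L X).

Section CoordinateAlgebra.
Variables (L : language) (B : algebra L) (n : nat) (Y : set ('I_n.+1 -> B)).

Definition theta : rel (term L 'I_n.+1) := fun t s => `[< Rad Y (t, s) >].

Lemma theta_equiv : equiv_class_of theta.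
Proof.
split.
- by move=> t; apply/asboolP => p _.
- by move=> t s; apply/asboolP/asboolP => h p Yp; apply/esym/h.
- move=> t s u /asboolP h1 /asboolP h2; apply/asboolP => p Yp.
  exact: etrans (h1 p Yp) (h2 p Yp).
Qed.

Canonical theta_rel := EquivRelPack theta_equiv.

Definition gamma_interp (f : symb L)
    (c : 'I_(arity f) -> {eq_quot theta_rel}) : {eq_quot theta_rel} :=
  \pi_({eq_quot theta_rel}) (App f (fun i => repr (c i))).

Definition Gamma : algebra L :=
  @Algebra L {eq_quot theta_rel} gamma_interp
    (inhabits (\pi_({eq_quot theta_rel}) (Var ord0))).

(* The operations do not depend on the choice of representatives. *)
Lemma gamma_interpE (f : symb L) (ts : 'I_(arity f) -> term L 'I_n.+1) :
  gamma_interp (fun i => \pi_({eq_quot theta_rel}) (ts i)) =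
  \pi_({eq_quot theta_rel}) (App f ts).
Proof.
apply/eqmodP/asboolP => p Yp; rewrite /satisfies /=; congr interp.
apply/funext => i.
have /eqmodP/asboolP/(_ p Yp) // :
  repr (\pi_({eq_quot theta_rel}) (ts i)) = ts i %[mod {eq_quot theta_rel}].
by rewrite reprK.
Qed.

End CoordinateAlgebra.

Section Notions.
Variables (L : language) (B : algebra L).

Definition coordinate_algebra (C : algebra L) :=
  exists (n : nat) (Y : set ('I_n.+1 -> B)),
    algebraic Y /\ isomorphic C (Gamma Y).

Definition irreducible_coordinate_algebra (C : algebra L) :=
  exists (n : nat) (Y : set ('I_n.+1 -> B)),
    irreducible Y /\ isomorphic C (Gamma Y).

Definition logically_irreducible n (Y : set ('I_n.+1 -> B)) :=
  algebraic Y /\ Ucl B (Gamma Y).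

Definition weakly_u_omega_compact :=
  forall (n : nat) (Y : set ('I_n.+1 -> B)),
    algebraic Y -> Y !=set0 -> Ucl B (Gamma Y) -> irreducible Y.

End Notions.

(* Main.v *)
Require Import Defs.
From mathcomp Require Import all_boot all_classical.
From mathcomp Require Import generic_quotient.
Local Open Scope classical_set_scope.

Set Implicit Arguments.
Unset Strict Implicit.
Unset Printing Implicit Defensive.

(* Homomorphisms Gamma(Y) -> B are the points of Y.  A decomposition of Y into
   proper algebraic subsets amounts to finitely many pairs of distinct elements
   of Gamma(Y) such that every point of Y identifies one of them; hence Y is
   irreducible iff B discriminates Gamma(Y).  Moreover the finitely generated
   algebras separated by B are exactly the coordinate algebras.  Under this
   dictionary the conditions become equivalent as soon as one knows that
   Dis(B) is contained in Ucl(B), and that a trivial Gamma(Y) with Y non-empty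
   is discriminated by B. *)

Lemma finite_range T (W : set T) :
  finite_set W -> exists (n : nat) (f : 'I_n -> T), W = range f.
Proof.
move=> /(@finite_seqP {classic T})[s ->].
exists (size s), (tnth (in_tuple s)); apply/seteqP; split => x /=.
  by move=> /(@tnthP _ _ (in_tuple s))[i ->]; exists i.
by move=> [i _ <-]; apply: (mem_tnth i (in_tuple s)).
Qed.

(** * Homomorphisms, finite generation, separation and discrimination *)

Section Algebras.
Context {L : language}.
Implicit Types A B C : algebra L.

Lemma hom_eval A B (h : A -> B) X (p : X -> A) (t : term L X) :
  hom h -> h (eval p t) = eval (h \o p) t.
Proof.
move=> hh; elim: t => //= f ts IH.
by rewrite hh; congr interp; apply/funext => i; exact: IH.
Qed.

Lemma hom_comp A B C (g : B -> C) (h : A -> B) : hom g -> hom h -> hom (g \o h).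
Proof. by move=> hg hh f a /=; rewrite hh hg. Qed.

Lemma isomorphic_sym A B : isomorphic A B -> isomorphic B A.
Proof.
move=> [h [hh [g hK gK]]]; exists g; split; last by exists h.
move=> f b; apply: (can_inj hK); rewrite gK hh.
by congr interp; apply/funext => i; rewrite gK.
Qed.

Lemma trivialP A : trivial A <-> forall a b : A, a = b.
Proof.
split=> [[h [_ /bij_inj hI]] a b|Aeq]; first by apply: hI; case: (h a) (h b) => [] [].
have [a0] := carrier_inhabited A.
by exists (fun=> tt); split=> //; exists (fun=> a0) => [a|[]] //; apply: Aeq.
Qed.

Lemma finitely_generatedP A :
  finitely_generated A <->
  exists (n : nat) (p : 'I_n.+1 -> A), forall a, exists t, a = eval p t.
Proof.
split=> [[W [/finite_range[n [f ->]]] genA]|[n [p pP]]].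
  have [a0] := carrier_inhabited A.
  (* There may be no generators at all, so the n + 1 variables include a spare one, [ord0], sent to
     the arbitrary element [a0]. *)
  pose p (i : 'I_n.+1) := oapp f a0 (unlift ord0 i).
  exists n, p => a.
  have : smallest (@subuniverse L A) (range f) a by rewrite genA.
  move=> /(_ [set b | exists t, b = eval p t]); apply; split.
    move=> g b /choice[ts bE]; exists (App g ts) => /=.
    by congr interp; apply/funext.
  by move=> _ [i _ <-]; exists (Var (lift ord0 i)); rewrite /= /p liftK.
exists (range p); split; first exact/finite_image/finite_finset.
apply/seteqP; split=> // a _ P [subP pP'].
have [t ->] := pP a; elim: t => [i|f ts IH] /=; first by apply: pP'; exists i.
exact: subP.
Qed.

Lemma finitely_generated_trivial A : trivial A -> finitely_generated A.
Proof.
move=> /trivialP Aeq; have [a0] := carrier_inhabited A.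
apply/finitely_generatedP; exists 0, (fun=> a0) => a.
by exists (Var ord0); apply: Aeq.
Qed.

Lemma Res_trivial B A : trivial A -> Res B A.
Proof. by move=> /trivialP Aeq a b /(_ (Aeq a b)). Qed.

Lemma Dis_Res B A : Dis B A -> Res B A.
Proof.
move=> BA a b ab; have [|h [hh hI]] := BA [set a; b].
  by rewrite finite_setU; split; apply: finite_set1.
exists h; split=> // /hI eq_ab; apply: ab.
by apply: eq_ab; rewrite inE /=; [left|right].
Qed.

Lemma Dis_trans A B C : Dis C B -> Dis B A -> Dis C A.
Proof.
move=> CB BA W finW; have [h [hh hI]] := BA W finW.
have [g [hg gI]] := CB (h @` W) (finite_image h finW).
exists (g \o h); split; first exact: hom_comp.
move=> a b aW bW /= /gI eq_h; apply: hI => //; apply: eq_h.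
  by rewrite inE; exists a => //; rewrite inE in aW.
by rewrite inE; exists b => //; rewrite inE in bW.
Qed.

Lemma isomorphic_Dis A B : isomorphic A B -> Dis B A.
Proof.
by move=> [h [hh /bij_inj hI]] W _; exists h; split=> // a b _ _ /hI.
Qed.

(* W collects the values of the terms occurring in phi. *)
Lemma holds_hom A X (p : X -> A) (phi : qf_formula L X) :
  exists W : set A, finite_set W /\
    forall B (h : A -> B), hom h -> set_inj W h ->
      (holds p phi <-> holds (h \o p) phi).
Proof.
have split_inj (W1 W2 : set A) (T : Type) (h : A -> T) : set_inj (W1 `|` W2) h ->
    set_inj W1 h /\ set_inj W2 h.
  by move=> hI; split=> a b; rewrite !inE => aW bW; apply: hI; rewrite inE;
    [left|left|right|right].
elim: phi => [[t s]|phi [W [finW WP]]|phi1 [W1 [fin1 W1P]] phi2 [W2 [fin2 W2P]]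
             |phi1 [W1 [fin1 W1P]] phi2 [W2 [fin2 W2P]]].
- exists [set eval p t; eval p s]; split.
    by rewrite finite_setU; split; apply: finite_set1.
  move=> B h hh hI; rewrite /= /satisfies /= -!hom_eval //; split=> [->//|].
  by apply: hI; rewrite inE /=; [left|right].
(* This case is why the claim is an equivalence: an implication alone would not survive negation. *)
- by exists W; split=> // B h hh hI /=; rewrite (WP B h).
- exists (W1 `|` W2); split; first by rewrite finite_setU.
  move=> B h hh /split_inj[hI1 hI2] /=.
  by rewrite (W1P B h) // (W2P B h).
- exists (W1 `|` W2); split; first by rewrite finite_setU.
  move=> B h hh /split_inj[hI1 hI2] /=.
  by rewrite (W1P B h) // (W2P B h).
Qed.

(** The truth of [phi] at [p] depends on finitely many elements of [A]; a homomorphism injective on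
    them transfers it to the point [h \o p] of [B], where [phi] holds. *)
Lemma Dis_Ucl B A : Dis B A -> Ucl B A.
Proof.
move=> BA [n phi] Bphi p /=; have [W [finW WP]] := holds_hom p phi.
have [h [hh hI]] := BA W finW.
by apply/(WP B h hh hI); apply: Bphi.
Qed.

Lemma Ucl_isomorphic B A C : isomorphic A C -> Ucl B A -> Ucl B C.
Proof.
move=> /isomorphic_sym /isomorphic_Dis /Dis_Ucl AC BA phi /BA.
exact: AC.
Qed.

Lemma isomorphic_trivial A B : trivial A -> trivial B -> isomorphic A B.
Proof.
move=> /trivialP Aeq /trivialP Beq.
have [a0] := carrier_inhabited A; have [b0] := carrier_inhabited B.
exists (fun=> b0); split; first by move=> f a; apply: Beq.
by exists (fun=> a0) => x; [apply: Aeq|apply: Beq].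
Qed.

End Algebras.

(** * Coordinate algebras: points and homomorphisms into [B] *)

Section CoordinateAlgebras.
Context {L : language} {B : algebra L}.

(** Here and in [term_repr], classes are typed in [Gamma Y] rather than in the bare quotient, so
    that [interp], [eval] and [hom] apply to them. *)
Definition term_class {n} (Y : set ('I_n.+1 -> B)) (t : term L 'I_n.+1) :
  Gamma Y := (\pi_({eq_quot theta_rel Y}) t)%qT.

Definition term_repr {n} {Y : set ('I_n.+1 -> B)} (c : Gamma Y) :
  term L 'I_n.+1 := repr (c : {eq_quot theta_rel Y}%qT).

Section Points.
Context {n : nat} {Y : set ('I_n.+1 -> B)}.

Lemma term_classP t s : term_class Y t = term_class Y s <-> Rad Y (t, s).
Proof.
by split=> [/eqmodP/asboolP|Yts] //; apply/eqmodP/asboolP.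
Qed.

Lemma term_reprK (c : Gamma Y) : term_class Y (term_repr c) = c.
Proof. exact: reprK. Qed.

Lemma term_class_surj (c : Gamma Y) : exists t, c = term_class Y t.
Proof. by exists (term_repr c); rewrite term_reprK. Qed.

Lemma interp_term_class f (ts : 'I_(arity f) -> term L 'I_n.+1) :
  interp (fun i => term_class Y (ts i)) = term_class Y (App f ts).
Proof. exact: gamma_interpE. Qed.

Lemma eval_term_class t :
  eval (fun i => term_class Y (Var i)) t = term_class Y t.
Proof.
elim: t => // f ts IH; rewrite -interp_term_class.
by congr (@interp _ (Gamma Y) f _); apply/funext.
Qed.

Lemma finitely_generated_Gamma : finitely_generated (Gamma Y).
Proof.
apply/finitely_generatedP; exists n, (fun i => term_class Y (Var i)) => c.
by have [t ->] := term_class_surj c; exists t; rewrite eval_term_class.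
Qed.

(** Evaluation at [p] is constant on classes because a point of [Y] satisfies every equation of
    [Rad Y]. *)
Lemma hom_of_point p : Y p ->
  exists h : Gamma Y -> B, hom h /\ forall t, h (term_class Y t) = eval p t.
Proof.
move=> Yp; pose h (c : Gamma Y) := eval p (term_repr c).
have hE t : h (term_class Y t) = eval p t.
  have /term_classP/(_ p Yp) // :
    term_class Y (term_repr (term_class Y t)) = term_class Y t.
  exact: term_reprK.
exists h; split=> // f c; have [ts cE] := choice (fun i => term_class_surj (c i)).
rewrite (funext cE) interp_term_class hE /=.
by congr (interp _); apply/funext => i; rewrite hE.
Qed.

(** The point consists of the images of the variables. The equations of a system defining [Y] hold
    between classes in [Gamma Y], so [h] carries them over to this point. *)
Lemma point_of_hom (h : Gamma Y -> B) : algebraic Y -> hom h ->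
  exists2 p, Y p & forall t, h (term_class Y t) = eval p t.
Proof.
move=> [S YE] hh; pose p i := h (term_class Y (Var i)).
have hE t : h (term_class Y t) = eval p t by rewrite -eval_term_class hom_eval.
exists p => //; rewrite YE => -[t s] Sts; rewrite /satisfies /= -!hE; congr h.
by apply/term_classP; rewrite YE => q /(_ _ Sts).
Qed.

Lemma Gamma_empty : ~ (Y !=set0) -> trivial (Gamma Y).
Proof.
move=> Y0; apply/trivialP => c d.
have [t ->] := term_class_surj c; have [s ->] := term_class_surj d.
by apply/term_classP => p Yp; case: Y0; exists p.
Qed.

Lemma Res_Gamma : Res B (Gamma Y).
Proof.
move=> c d; have [t ->] := term_class_surj c; have [s ->] := term_class_surj d.
move=> ts; have [p Yp pts] : exists2 p, Y p & eval p t <> eval p s.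
  apply: contrapT => nex; apply/ts/term_classP => p Yp.
  by apply: contrapT => pts; apply: nex; exists p.
by have [h [hh hE]] := hom_of_point Yp; exists h; rewrite !hE.
Qed.

(** A point supplies the homomorphism, and injectivity is automatic. For empty [Y] this can fail:
    [Gamma Y] is then trivial, hence discriminated only if [B] has a one-element subalgebra. *)
Lemma Dis_Gamma_trivial : Y !=set0 -> trivial (Gamma Y) -> Dis B (Gamma Y).
Proof.
move=> [p /hom_of_point[h [hh _]]] /trivialP Geq W _.
by exists h; split=> // c d _ _ _; apply: Geq.
Qed.

(** * Irreducibility and discrimination *)

Lemma algebraic_setI_eq t s : algebraic Y ->
  algebraic (Y `&` [set p | eval p t = eval p s]).
Proof.
move=> [S ->]; exists (S `|` [set (t, s)]).
apply/seteqP; split=> p; first by move=> [pS pts] e [/pS //|->].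
by move=> pS; split=> [e Se|]; [apply: pS; left|apply: (pS (t, s)); right].
Qed.

(** If every member were proper, enumerating [I] would give a forbidden decomposition. The index
    type is an arbitrary finite one because the lemma is applied to pairs of indices. *)
Lemma irreducible_cover (I : finType) (Z : I -> set ('I_n.+1 -> B)) :
  irreducible Y -> (forall i, algebraic (Z i) /\ Z i `<=` Y) ->
  Y `<=` \bigcup_(i in setT) Z i -> exists i, Z i = Y.
Proof.
move=> [_ _ irrY] ZP YZ; apply: contrapT => nZ; apply: irrY.
exists #|I|, (fun k => Z (enum_val k)); split.
  move=> k; have [algZ ZY] := ZP (enum_val k); split=> //.
  split=> // YZk; apply: nZ; exists (enum_val k).
  by apply/seteqP; split.
apply/seteqP; split=> [p /YZ[i _ Zp]|p [k _]].
  by exists (enum_rank i) => //; rewrite enum_rankK.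
by apply: (ZP _).2.
Qed.

(** Were no homomorphism injective on [W], every point of [Y] would identify two distinct elements
    of [W], so the sets [Z] would cover [Y]. One of them is then [Y] itself, which makes its two
    elements equal in [Gamma Y]. *)
Lemma irreducible_Dis : irreducible Y -> Dis B (Gamma Y).
Proof.
move=> irrY W /finite_range[m [w ->]]; have [algY _ _] := irrY.
have [t wE] := choice (fun i => term_class_surj (w i)).
apply: contrapT => nDis.
pose I := {ij : 'I_m * 'I_m | `[< w ij.1 <> w ij.2 >]}.
pose Z (ij : I) :=
  Y `&` [set p | eval p (t (val ij).1) = eval p (t (val ij).2)].
have [||[[i j] wij] ZE] := irreducible_cover (Z := Z) irrY.
- by move=> ij; split; [apply: algebraic_setI_eq|move=> p []].
- move=> p Yp; have [h [hh hE]] := hom_of_point Yp.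
  apply: contrapT => nZ; apply: nDis; exists h; split=> // c d.
  rewrite !inE => -[i _ <-] [j _ <-] hij; apply: contrapT => wij; apply: nZ.
  exists (exist _ (i, j) (introT (asboolP _) wij)) => //.
  by split=> //=; rewrite -!hE -!wE.
- have /asboolP := wij; rewrite /= !wE; apply; apply/term_classP => p.
  by rewrite -ZE => -[_].
Qed.

(** Each proper piece satisfies an equation that fails somewhere on [Y]. A homomorphism injective on
    the sides of all these equations gives a point of [Y] outside every piece. *)
Lemma Dis_irreducible : algebraic Y -> Dis B (Gamma Y) -> irreducible Y.
Proof.
move=> algY BY; split=> //.
  (* Injectivity on the empty set asks nothing; any homomorphism provides a point of [Y]. *)
  have [h [hh _]] := BY _ (finite_set0 _).
  by have [p Yp _] := point_of_hom algY hh; exists p.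
move=> [k [Z [ZP YE]]].
have /choice[e eP] (i : 'I_k) : exists e, Rad (Z i) e /\ ~ Rad Y e.
  have [[S ZE] [_ nYZ]] := ZP i.
  apply: contrapT => nex; apply: nYZ => p Yp; rewrite ZE => e Se.
  apply: contrapT => npe; apply: nex; exists e; split.
    by move=> q; rewrite ZE; apply.
  by move=> /(_ p Yp).
pose W := range (fun i => term_class Y (e i).1) `|`
          range (fun i => term_class Y (e i).2).
have finW : finite_set W.
  by rewrite finite_setU; split; apply/finite_image/finite_finset.
have [h [hh hI]] := BY W finW.
have [p Yp hE] := point_of_hom algY hh.
have [i _ Zip] : (\bigcup_(i in setT) Z i) p by rewrite -YE.
have [Zie] := eP i; apply.
rewrite [e i]surjective_pairing; apply/term_classP; apply: hI.
- by rewrite inE; left; exists i.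
- by rewrite inE; right; exists i.
- by rewrite !hE; apply: Zie.
Qed.

End Points.

(** Let [Y] be cut out by all relations between the generators [q]. Every homomorphism [h] from [C]
    to [B] gives a point [h \o q] of [Y], so separation forces [Rad Y] to be the kernel of [eval q],
    and [C] is the same quotient of the term algebra as [Gamma Y]. *)
Lemma Res_coordinate (C : algebra L) :
  finitely_generated C -> Res B C -> coordinate_algebra B C.
Proof.
move=> /finitely_generatedP[n [q qP]] BC.
pose Y : set ('I_n.+1 -> B) := V [set e | satisfies q e].
have RadP t s : Rad Y (t, s) <-> eval q t = eval q s.
  split=> [Yts|qts p]; last by apply.
  apply: contrapT => /BC[h [hh]]; apply; rewrite !hom_eval //.
  apply: (Yts (h \o q)) => -[u v] quv.
  by rewrite /satisfies /= -!hom_eval // quv.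
exists n, Y; split; first by exists [set e | satisfies q e].
(* [r] chooses a term for each element of [C]; by [rq] the choice does not matter modulo [Rad Y]. *)
have [r rE] := choice qP.
have rq t : term_class Y (r (eval q t)) = term_class Y t.
  by apply/term_classP/RadP; rewrite -rE.
exists (fun c => term_class Y (r c)); split.
  move=> f c; rewrite interp_term_class -[RHS]rq /=.
  by congr (term_class Y (r (interp _))); apply/funext => i; rewrite -rE.
exists (eval q \o term_repr) => c /=.
  by rewrite [RHS]rE; apply/RadP/term_classP; rewrite term_reprK.
by rewrite rq term_reprK.
Qed.

End CoordinateAlgebras.

(** The fourth condition adjoins the trivial algebra on both sides: the right-hand class always
    contains it, while [Ucl B] may not, for instance if [B] satisfies f(x) <> x for all x. The
    second conjunct measures the difference from the version without this adjunction. *)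
Theorem proposition5p12 (L : language) (B : algebra L) :
  [<-> weakly_u_omega_compact B;
       forall (n : nat) (Y : set ('I_n.+1 -> B)),
         Y !=set0 -> logically_irreducible Y -> irreducible Y;
       forall C : algebra L,
         ~ trivial C -> coordinate_algebra B C -> Ucl B C ->
         irreducible_coordinate_algebra B C;
       forall C : algebra L,
         with_trivial (Ucl B) C /\ fin_gen (Res B) C <->
         fin_gen (with_trivial (Dis B)) C]
  /\
  ((forall C : algebra L,
      Ucl B C /\ fin_gen (Res B) C <-> fin_gen (with_trivial (Dis B)) C) <->
   weakly_u_omega_compact B /\ Ucl B (trivial_algebra L)).
Proof.
have Dis_cond (C : algebra L) : fin_gen (with_trivial (Dis B)) C ->
    with_trivial (Ucl B) C /\ fin_gen (Res B) C.
  move=> [[BC|trivC] fgC]; split; [left|split|right|split] => //.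
  - exact: Dis_Ucl.
  - exact: Dis_Res.
  - exact: Res_trivial.
have cond41 : (forall C : algebra L, with_trivial (Ucl B) C /\ fin_gen (Res B) C <->
    fin_gen (with_trivial (Dis B)) C) -> weakly_u_omega_compact B.
  move=> cond4 n Y algY Yn0 UY; apply: Dis_irreducible => //.
  have [|[//|trivY] _] := (cond4 (Gamma Y)).1; last exact: Dis_Gamma_trivial.
  by split; [left|split; [exact: Res_Gamma|exact: finitely_generated_Gamma]].
have cond23 : (forall (n : nat) (Y : set ('I_n.+1 -> B)),
    Y !=set0 -> logically_irreducible Y -> irreducible Y) ->
    forall C : algebra L, ~ trivial C -> coordinate_algebra B C -> Ucl B C ->
    irreducible_coordinate_algebra B C.
  move=> cond2 C ntC [n [Y [algY CY]]] UC; exists n, Y; split=> //.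
  apply: cond2; last by split=> //; apply: Ucl_isomorphic UC.
  (* An empty [Y] would make [Gamma Y], and with it [C], trivial. *)
  apply: contrapT => /Gamma_empty /trivialP Geq; apply: ntC; apply/trivialP => a b.
  by have [h [_ /bij_inj hI]] := CY; apply: hI.
have cond34 : (forall C : algebra L, ~ trivial C -> coordinate_algebra B C ->
    Ucl B C -> irreducible_coordinate_algebra B C) ->
    forall C : algebra L, with_trivial (Ucl B) C /\ fin_gen (Res B) C <->
    fin_gen (with_trivial (Dis B)) C.
  move=> cond3 C; split; last exact: Dis_cond.
  move=> [UC [BC fgC]]; split=> //.
  (* The third condition is silent on trivial algebras, which the adjoined class absorbs. *)
  have [trivC|ntC] := pselect (trivial C); first by right.
  have {}UC : Ucl B C by case: UC.
  have [n [Y [irrY CY]]] := cond3 C ntC (Res_coordinate fgC BC) UC.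
  by left; apply: Dis_trans (irreducible_Dis irrY) (isomorphic_Dis CY).
have cond12 : weakly_u_omega_compact B -> forall (n : nat) (Y : set ('I_n.+1 -> B)),
    Y !=set0 -> logically_irreducible Y -> irreducible Y.
  by move=> cond1 n Y Yn0 [algY UY]; apply: cond1.
split; first by tfae.
have triv1 : trivial (trivial_algebra L) by apply/trivialP => -[] [].
split=> [cond4'|[cond1 UE] C].
  (* The trivial algebra lies in the right-hand class, so the unadjoined equality puts it in
     [Ucl B]; both versions of the left-hand class then coincide. *)
  have UE : Ucl B (trivial_algebra L).
    apply: ((cond4' _).2 _).1; split; first by right.
    exact: finitely_generated_trivial.
  split=> //; apply: cond41 => C; rewrite -cond4'; split=> -[UC BC]; split=> //.
    case: UC => // trivC; apply: Ucl_isomorphic UE; exact: isomorphic_trivial.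
  by left.
rewrite -(cond34 (cond23 (cond12 cond1)) C); split=> -[UC BC]; split=> //.
  by left.
case: UC => // trivC; apply: Ucl_isomorphic UE; exact: isomorphic_trivial.
Qed.
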